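(* Suppose that $f(z)=h(z)+\overline{g(z)}=\sum_{k=0}^\infty a_k z^k+\overline{\sum_{k=1}^\infty b_k z^k}$ is a harmonic mapping in the unit disk $\mathbb{D}=\{z\in\mathbb{C}:|z|<1\}$, where $h$ and $g$ are analytic in $\mathbb{D}$, $\|h\|_\infty=1$ and $|g'(z)|\le |h'(z)|$ for all $z\in\mathbb{D}$. Then, for every $z\in\mathbb{D}$ with $|z|=r$, $$|a_0|+\sum_{k=1}^\infty(|a_k|+|b_k|)r^k+|h(z)-a_0|^2\le 1\quad\text{for } r\le \frac15.$$ The constant $1/5$ is best possible.
   Context: $\|h\|_\infty=\sup_{z\in\mathbb{D}}|h(z)|$. ''Best possible'' means that if $1/5$ is replaced by any larger number, the inequality fails for some $f$ satisfying the hypotheses and some $z$ with $|z|=r$ in the corresponding range. *)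

(* Defs.v *)
From Stdlib Require Export Reals.
From Coquelicot Require Export Coquelicot.

Open Scope R_scope.

Definition in_disk (z : C) : Prop := Cmod z < 1.

Definition analytic_on_disk (h : C -> C) : Prop :=
  forall z : C, in_disk z ->
    ex_derive (K := C_AbsRing) (V := C_NormedModule) h z.

Definition has_power_series_on_disk (a : nat -> C) (h : C -> C) : Prop :=
  forall z : C, in_disk z ->
    is_pseries (K := C_AbsRing) (V := C_NormedModule) a z (h z).

Definition sup_norm_disk (h : C -> C) : Rbar :=
  Lub_Rbar (fun x : R => exists z : C, in_disk z /\ x = Cmod (h z)).

(* [b 0 = 0] encodes that the power series of [g] starts at [k = 1].
   [C_derive] takes its limit along the real direction only; under
   [analytic_on_disk] it is the complex derivative ([C_derive_correct]). *)
Record admissible (f h g : C -> C) (a b : nat -> C) : Prop := {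
  adm_f : forall z : C, in_disk z -> f z = (h z + Cconj (g z))%C;
  adm_h_analytic : analytic_on_disk h;
  adm_g_analytic : analytic_on_disk g;
  adm_h_series : has_power_series_on_disk a h;
  adm_g_series : has_power_series_on_disk b g;
  adm_b0 : b 0%nat = RtoC 0;
  adm_h_norm : sup_norm_disk h = Finite 1;
  adm_dilatation : forall z : C, in_disk z ->
    Cmod (C_derive g z) <= Cmod (C_derive h z)
}.

Definition bohr_term (a b : nat -> C) (r : R) (k : nat) : R :=
  (Cmod (a k) + Cmod (b k)) * r ^ k.

(* [Series] is only meaningful when the series converges, so statements about
   [bohr_sum] are paired with an [ex_series] claim. *)
Definition bohr_sum (h : C -> C) (a b : nat -> C) (r : R) (z : C) : R :=
  Cmod (a 0%nat)
  + Series (fun k : nat => bohr_term a b r (S k))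
  + Cmod (h z - a 0%nat)%C ^ 2.

(* Main.v *)
Require Import Defs.
From Stdlib Require Import Reals Lra Lia.
From Coquelicot Require Import Coquelicot.
Open Scope R_scope.

(** Write A = |a_0|, L = 1 - A^2 and t = r / (1 - r), so that r <= 1/5 means
    t <= 1/4.  Everything rests on one form of Parseval's identity
    ([mean_square_le]): if |G| <= |F| on the disk, then the sum of
    |G_k|^2 x^k is at most the sum of |F_k|^2 x^k for 0 <= x < 1.  Averaging
    over roots of unity makes Parseval's identity exact for polynomials, and
    truncating the power series costs only an error that tends to 0.

    Coefficients of h ([bounded_coef_le]).  Since |h| <= 1, multiplication by h
    does not increase the mean square of al + be z^n.  Reading off the
    coefficients of order 0 and n gives
    |al a_0|^2 + |al a_n + be a_0|^2 <= |al|^2 + |be|^2, and the choice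
    al = L, be = conj(a_0) a_n yields |a_n| <= L.

    Coefficients of g.  Applying the mean square comparison to |g'| <= |h'|
    bounds the sum of k^2 |b_k|^2 x^(k-1) by the sum of k^2 |a_k|^2 x^(k-1).
    For D(x), the sum over k >= 1 of (|a_k|^2 - |b_k|^2) x^k, this says that
    (x D')' >= 0, hence D' >= 0 and D >= 0 ([tail_square_le_of_derive]).  So
    the sum of |b_k|^2 r^k is at most L^2 t, and the Cauchy-Schwarz inequality
    gives L t as a bound for the sum of |b_k| r^k.

    The left-hand side is therefore at most A + 2 L t + (L t)^2, which for
    t <= 1/4 is at most 1 - (1 - A)^2 (1/2 - (1 + A)^2 / 16) <= 1.

    For the sharpness take h(z) = (a - z) / (1 - a z) and g = h - a.  Then
    |b_k| = |a_k| for k >= 1, and A + 2 L r / (1 - a r) exceeds 1 exactly when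
    r (2 + 3 a) > 1; any r > 1/5 satisfies this once a is close to 1. *)

(** * Parseval's identity at the roots of unity *)

(** Sums produce equations typed in an algebraic structure; [ring] needs the
    carrier itself. *)
Ltac Cring := match goal with |- @eq _ ?x ?y => change (@eq C x y); ring end.

Ltac Rplus_norm :=
  repeat match goal with |- context [@plus ?G ?x ?y] =>
    progress change (@plus G x y) with (Rplus x y) end.

Ltac Rring := match goal with |- @eq _ ?x ?y => change (@eq R x y); ring end.

Definition cis (t : R) : C := (cos t, sin t).

Lemma cis_plus (s t : R) : cis (s + t) = (cis s * cis t)%C.
Proof.
  unfold cis, Cmult; simpl. rewrite cos_plus, sin_plus.
  f_equal; ring.
Qed.

Lemma Cmod_cis (t : R) : Cmod (cis t) = 1.
Proof.
  unfold Cmod, cis; simpl.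
  replace (cos t * (cos t * 1) + sin t * (sin t * 1)) with 1.
  - apply sqrt_1.
  - generalize (sin2_cos2 t); unfold Rsqr; lra.
Qed.

Lemma cis_pow (t : R) (n : nat) : (cis t ^ n)%C = cis (INR n * t).
Proof.
  induction n as [|n IH].
  - simpl. rewrite Rmult_0_l. unfold cis. rewrite cos_0, sin_0. reflexivity.
  - rewrite Cpow_S, IH, <- cis_plus, S_INR. f_equal; ring.
Qed.

(** From the half-angle formula cos t = 1 - 2 sin^2 (t/2), as sin is positive
    on the open interval from 0 to PI. *)
Lemma cis_eq_1 (t : R) : cis t = 1 -> t <= 0 \/ 2 * PI <= t.
Proof.
  intros E. apply (f_equal fst) in E. unfold cis in E; cbn [fst] in E.
  destruct (Rle_lt_dec t 0) as [|H0]; [now left|].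
  destruct (Rle_lt_dec (2 * PI) t) as [|H1]; [now right|].
  exfalso.
  assert (Hs : 0 < sin (t / 2)) by (apply sin_gt_0; lra).
  replace t with (2 * (t / 2)) in E by field.
  rewrite cos_2a_sin in E. simpl in E.
  nra.
Qed.

(** Indexed by n so that its order n + 1 is the number of terms of [sum_n _ n]. *)
Definition root_of_unity (n : nat) : C := cis (2 * PI / INR (S n)).

Lemma root_of_unity_pow (n : nat) : (root_of_unity n ^ S n)%C = 1.
Proof.
  unfold root_of_unity. rewrite cis_pow.
  replace (INR (S n) * (2 * PI / INR (S n))) with (2 * PI)
    by (field; apply not_0_INR; lia).
  unfold cis. rewrite cos_2PI, sin_2PI. reflexivity.
Qed.

Lemma root_of_unity_pow_neq_1 (n d : nat) :
  (0 < d <= n)%nat -> (root_of_unity n ^ d)%C <> 1.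
Proof.
  intros [Hd Hn] E. unfold root_of_unity in E. rewrite cis_pow in E.
  assert (HN : 0 < INR (S n)) by (apply lt_0_INR; lia).
  assert (HD : 0 < INR d) by (apply lt_0_INR; lia).
  assert (HL : INR d < INR (S n)) by (apply lt_INR; lia).
  pose proof PI_RGT_0 as HP.
  assert (HE : INR d * (2 * PI / INR (S n)) = 2 * PI * (INR d / INR (S n)))
    by (field; lra).
  rewrite HE in E.
  assert (H1 : 0 < INR d / INR (S n)) by (apply Rdiv_lt_0_compat; lra).
  assert (H2 : INR d / INR (S n) < 1) by (apply Rlt_div_l; lra).
  apply cis_eq_1 in E. destruct E; nra.
Qed.

Lemma Cgeom_sum (w : C) (n : nat) :
  ((w - 1) * sum_n (fun j : nat => w ^ j) n = w ^ S n - 1)%C.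
Proof.
  induction n as [|n IH].
  - rewrite sum_O. simpl. ring.
  - rewrite sum_Sn.
    change (plus (sum_n (fun j : nat => w ^ j)%C n) (w ^ S n)%C)
      with (sum_n (fun j : nat => w ^ j)%C n + w ^ S n)%C.
    rewrite Cmult_plus_distr_l, IH, (Cpow_S w (S n)). ring.
Qed.

Lemma root_of_unity_sum (n d : nat) :
  (0 < d <= n)%nat ->
  sum_n (fun j : nat => ((root_of_unity n ^ d) ^ j)%C) n = RtoC 0.
Proof.
  intros Hd.
  pose proof (Cgeom_sum (root_of_unity n ^ d) n) as E.
  rewrite <- Cpow_mult_r, Nat.mul_comm, Cpow_mult_r, root_of_unity_pow in E.
  rewrite Cpow_1_l in E.
  replace (RtoC 1 - RtoC 1)%C with (RtoC 0) in E by ring.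
  assert (Hw : (root_of_unity n ^ d - 1)%C <> 0).
  { intros H. apply (root_of_unity_pow_neq_1 n d Hd).
    replace (root_of_unity n ^ d)%C with ((root_of_unity n ^ d - 1) + 1)%C by ring.
    rewrite H. ring. }
  rewrite <- (Cmult_1_l (sum_n _ _)), <- (Cinv_l _ Hw), <- Cmult_assoc, E. Cring.
Qed.

Lemma Cmod_plus_sqr (p q : C) :
  Cmod (p + q) ^ 2 = Cmod p ^ 2 + Cmod q ^ 2 + 2 * Re (p * Cconj q)%C.
Proof. rewrite !Cmod2_alt. destruct p, q. simpl. ring. Qed.

Lemma sum_n_Rmult_l (c : R) (u : nat -> R) (n : nat) :
  sum_n (fun k : nat => c * u k) n = c * sum_n u n.
Proof. exact (sum_n_mult_l (K := R_Ring) c u n). Qed.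

Lemma sum_n_Cmult_l (c : C) (u : nat -> C) (n : nat) :
  sum_n (fun k : nat => (c * u k)%C) n = (c * sum_n u n)%C.
Proof. exact (sum_n_mult_l (K := C_Ring) c u n). Qed.

Lemma sum_n_Cmult_r (c : C) (u : nat -> C) (n : nat) :
  sum_n (fun k : nat => (u k * c)%C) n = (sum_n u n * c)%C.
Proof. exact (sum_n_mult_r (K := C_Ring) c u n). Qed.

Lemma Re_sum_n (u : nat -> C) (n : nat) :
  Re (sum_n u n) = sum_n (fun k : nat => Re (u k)) n.
Proof.
  induction n as [|n IH].
  - now rewrite !sum_O.
  - rewrite !sum_Sn, <- IH. reflexivity.
Qed.

Lemma Im_sum_n (u : nat -> C) (n : nat) :
  Im (sum_n u n) = sum_n (fun k : nat => Im (u k)) n.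
Proof.
  induction n as [|n IH].
  - now rewrite !sum_O.
  - rewrite !sum_Sn, <- IH. reflexivity.
Qed.

Lemma root_of_unity_mult_conj (n : nat) :
  (root_of_unity n * Cconj (root_of_unity n))%C = 1.
Proof.
  rewrite <- Cmod2_conj. unfold root_of_unity. rewrite Cmod_cis.
  simpl. f_equal. ring.
Qed.

(** On the unit circle the conjugate is the inverse, so the summand is the
    conjugate of (w^(l-k))^j and the sum is a vanishing geometric one. *)
Lemma root_of_unity_orthogonal (n k l : nat) :
  (k < l <= n)%nat ->
  sum_n (fun j : nat => ((root_of_unity n ^ j) ^ k
                         * Cconj ((root_of_unity n ^ j) ^ l))%C) n = RtoC 0.
Proof.
  intros Hkl. set (w := root_of_unity n).
  assert (HE : forall j : nat,
    ((w ^ j) ^ k * Cconj ((w ^ j) ^ l))%C = Cconj ((w ^ (l - k)) ^ j)).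
  { intros j. replace l with (k + (l - k))%nat at 1 by lia.
    rewrite Cpow_add_r, Cmult_conj, Cmult_assoc.
    rewrite (Cpow_conj (w ^ j) k), <- Cpow_mult_l, Cpow_conj, <- Cpow_mult_l.
    unfold w at 1 2. rewrite root_of_unity_mult_conj, !Cpow_1_l, Cmult_1_l.
    rewrite <- !Cpow_mult_r. f_equal. f_equal. lia. }
  assert (HC : forall m : nat,
    sum_n (fun j : nat => ((w ^ j) ^ k * Cconj ((w ^ j) ^ l))%C) m
    = Cconj (sum_n (fun j : nat => ((w ^ (l - k)) ^ j)%C) m)).
  { induction m as [|m IH].
    - now rewrite !sum_O, HE.
    - rewrite !sum_Sn, IH, HE. symmetry. apply Cplus_conj. }
  rewrite HC. unfold w. rewrite root_of_unity_sum by lia.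
  unfold Cconj; simpl. unfold RtoC. f_equal. ring.
Qed.

(** Adding the term of degree m + 1 contributes its own square and a cross term;
    the cross terms cancel on average by orthogonality, provided that all degrees
    stay below the number of sample points. *)
Lemma finite_Parseval (c : nat -> C) (n m : nat) :
  (m <= n)%nat ->
  sum_n (fun j : nat =>
           Cmod (sum_n (fun k : nat => (c k * (root_of_unity n ^ j) ^ k)%C) m) ^ 2) n
  = INR (S n) * sum_n (fun k : nat => Cmod (c k) ^ 2) m.
Proof.
  set (w := root_of_unity n).
  assert (Hw : forall j k : nat, Cmod ((w ^ j) ^ k)%C = 1).
  { intros j k. rewrite !Cmod_pow. unfold w, root_of_unity.
    rewrite Cmod_cis, !pow1. reflexivity. }
  induction m as [|m IH]; intros Hm.
  - rewrite sum_O, <- sum_n_const. apply sum_n_ext. intros j.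
    rewrite sum_O, Cmod_mult, Hw, Rmult_1_r. reflexivity.
  - rewrite sum_Sn, <- sum_n_const.
    rewrite (sum_n_ext _ (fun j : nat => plus (plus
      (Cmod (sum_n (fun k : nat => (c k * (w ^ j) ^ k)%C) m) ^ 2)
      (Cmod (c (S m)) ^ 2))
      (2 * Re (sum_n (fun k : nat => (c k * Cconj (c (S m)) *
                  ((w ^ j) ^ k * Cconj ((w ^ j) ^ (S m))))%C) m)))).
    2:{ intros j. rewrite sum_Sn.
        change (plus (sum_n (fun k : nat => (c k * (w ^ j) ^ k)%C) m)
                     (c (S m) * (w ^ j) ^ S m)%C)
          with ((sum_n (fun k : nat => (c k * (w ^ j) ^ k)%C) m)
                     + (c (S m) * (w ^ j) ^ S m))%C.
        rewrite Cmod_plus_sqr, Cmod_mult, Hw, Rmult_1_r.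
        Rplus_norm.
        f_equal. f_equal. f_equal.
        rewrite <- sum_n_Cmult_r. apply sum_n_ext. intros k.
        rewrite Cmult_conj. Cring. }
    rewrite !sum_n_plus, IH by lia.
    rewrite sum_n_const.
    (* the cross terms, summed over the sample points *)
    assert (HZ : sum_n (fun j : nat => 2 * Re (sum_n (fun k : nat =>
        (c k * Cconj (c (S m)) * ((w ^ j) ^ k * Cconj ((w ^ j) ^ (S m))))%C) m)) n = 0).
    { rewrite sum_n_Rmult_l, <- Re_sum_n.
      rewrite (sum_n_switch (fun j k : nat =>
         (c k * Cconj (c (S m)) * ((w ^ j) ^ k * Cconj ((w ^ j) ^ (S m))))%C)).
      rewrite (sum_n_ext_loc _ (fun _ => RtoC 0)).
      - rewrite Re_sum_n. unfold Re, RtoC. simpl. rewrite sum_n_const.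
        unfold mult; simpl. ring.
      - intros k Hk. rewrite sum_n_Cmult_l. unfold w.
        rewrite root_of_unity_orthogonal by lia. Cring. }
    rewrite HZ, sum_n_const. Rplus_norm. Rring.
Qed.

(** * Power series in the disk and their mean squares *)

Lemma is_series_C_eps (u : nat -> C) (l : C) :
  is_series (K := C_AbsRing) (V := C_NormedModule) u l <->
  forall eps : R, 0 < eps -> exists N : nat, forall n : nat, (N <= n)%nat ->
    Cmod (sum_n u n - l)%C < eps.
Proof.
  unfold is_series. split; intros H.
  - intros eps He.
    pose proof (proj1 (filterlim_locally_ball_norm (K := C_AbsRing)
                  (U := C_NormedModule) (F := eventually) (sum_n u) l) H
                  (mkposreal eps He)) as [N HN].
    exists N. intros n Hn. exact (HN n Hn).
  - apply (filterlim_locally_ball_norm (K := C_AbsRing)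
                  (U := C_NormedModule) (F := eventually) (sum_n u) l).
    intros [eps He]. destruct (H eps He) as [N HN].
    exists N. intros n Hn. exact (HN n Hn).
Qed.

Lemma pow_n_Cpow (z : C) (k : nat) : pow_n (K := C_Ring) z k = (z ^ k)%C.
Proof.
  induction k as [|k IH].
  - reflexivity.
  - rewrite Cpow_S. rewrite <- IH at 1. reflexivity.
Qed.

Lemma is_pseries_C (c : nat -> C) (z l : C) :
  is_pseries (K := C_AbsRing) (V := C_NormedModule) c z l <->
  is_series (K := C_AbsRing) (V := C_NormedModule)
    (fun k : nat => (c k * z ^ k)%C) l.
Proof.
  assert (E : forall k : nat,
    scal (K := C_Ring) (V := C_NormedModule) (pow_n (K := C_Ring) z k) (c k)
    = (c k * z ^ k)%C).
  { intros k. rewrite pow_n_Cpow. apply Cmult_comm. }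
  unfold is_pseries. split; apply is_series_ext; intros k; rewrite <- E; reflexivity.
Qed.

Lemma is_series_C_bounded (u : nat -> C) (l : C) :
  is_series (K := C_AbsRing) (V := C_NormedModule) u l ->
  exists M : R, forall n : nat, Cmod (u n) <= M.
Proof.
  intros H.
  destruct (filterlim_bounded (K := C_AbsRing) (V := C_NormedModule)
              (sum_n u)) as [M HM].
  { exists l. exact H. }
  exists (M + M). intros n.
  assert (HM' : forall k, Cmod (sum_n u k) <= M) by exact HM.
  destruct n as [|n].
  - pose proof (HM' 0%nat) as H0. rewrite sum_O in H0.
    pose proof (Cmod_ge_0 (u 0%nat)). lra.
  - pose proof (HM' (S n)) as H1. pose proof (HM' n) as H0.
    rewrite sum_Sn in H1.
    replace (u (S n)) with (plus (sum_n u n) (u (S n)) + - sum_n u n)%C.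
    2:{ change (plus (sum_n u n) (u (S n))) with (sum_n u n + u (S n))%C. ring. }
    eapply Rle_trans; [apply Cmod_triangle|]. rewrite Cmod_opp. lra.
Qed.

Lemma CV_radius_ge_1 (u : nat -> R) :
  (forall r : R, 0 <= r < 1 -> exists M : R, forall n : nat, Rabs (u n * r ^ n) <= M) ->
  Rbar_le 1 (CV_radius u).
Proof.
  intros H. destruct (CV_radius_bounded u) as [Hub _].
  apply Rbar_not_lt_le. intros Hlt.
  assert (H0 : Rbar_le 0 (CV_radius u)) by apply CV_radius_ge_0.
  destruct (CV_radius u) as [l| |]; simpl in *; try easy.
  specialize (Hub ((l + 1) / 2)). simpl in Hub.
  enough ((l + 1) / 2 <= l) by lra.
  apply Hub, H. lra.
Qed.

Lemma Rbar_lt_CV_radius (u : nat -> R) (x : R) :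
  Rbar_le 1 (CV_radius u) -> 0 <= x < 1 -> Rbar_lt (Rabs x) (CV_radius u).
Proof.
  intros H Hx. eapply Rbar_lt_le_trans; [|exact H].
  simpl. rewrite Rabs_pos_eq; lra.
Qed.

Lemma disk_coef_bound (c : nat -> C) (F : C -> C) (r : R) :
  has_power_series_on_disk c F -> 0 <= r < 1 ->
  exists M : R, forall n : nat, Cmod (c n) * r ^ n <= M.
Proof.
  intros H Hr.
  assert (Hz : in_disk (RtoC r)).
  { unfold in_disk. rewrite Cmod_R, Rabs_pos_eq; lra. }
  destruct (is_series_C_bounded _ _ (proj1 (is_pseries_C _ _ _) (H _ Hz))) as [M HM].
  exists M. intros n. specialize (HM n).
  rewrite Cmod_mult, Cmod_pow, Cmod_R, Rabs_pos_eq in HM; lra.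
Qed.

Lemma CV_radius_disk (c : nat -> C) (F : C -> C) :
  has_power_series_on_disk c F -> Rbar_le 1 (CV_radius (fun k : nat => Cmod (c k))).
Proof.
  intros H. apply CV_radius_ge_1. intros r Hr.
  destruct (disk_coef_bound c F r H Hr) as [M HM].
  exists M. intros n. rewrite Rabs_pos_eq; [apply HM|].
  apply Rmult_le_pos; [apply Cmod_ge_0|apply pow_le; lra].
Qed.

(** |c_n|^2 r^n is the square of |c_n| (sqrt r)^n, and sqrt r < 1 as well. *)
Lemma CV_radius_disk_sqr (c : nat -> C) (F : C -> C) :
  has_power_series_on_disk c F ->
  Rbar_le 1 (CV_radius (fun k : nat => Cmod (c k) ^ 2)).
Proof.
  intros H. apply CV_radius_ge_1. intros r Hr.
  destruct (disk_coef_bound c F (sqrt r) H) as [M HM].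
  { split; [apply sqrt_pos|]. rewrite <- sqrt_1. apply sqrt_lt_1; lra. }
  exists (M ^ 2). intros n.
  replace (Cmod (c n) ^ 2 * r ^ n) with ((Cmod (c n) * sqrt r ^ n) ^ 2).
  2:{ rewrite Rpow_mult_distr, <- pow_mult, Nat.mul_comm, pow_mult, pow2_sqrt; lra. }
  rewrite <- RPow_abs. apply pow_incr. split; [apply Rabs_pos|].
  rewrite Rabs_pos_eq; [apply HM|].
  apply Rmult_le_pos; [apply Cmod_ge_0|apply pow_le, sqrt_pos].
Qed.

Lemma Cmod_sum_n (u : nat -> C) (n : nat) :
  Cmod (sum_n u n) <= sum_n (fun k : nat => Cmod (u k)) n.
Proof.
  induction n as [|n IH].
  - rewrite !sum_O. apply Rle_refl.
  - rewrite !sum_Sn. eapply Rle_trans; [apply Cmod_triangle|].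
    apply Rplus_le_compat_r, IH.
Qed.

Lemma sum_n_le_Rseries (u : nat -> R) (s : R) (n : nat) :
  (forall k : nat, 0 <= u k) -> is_series u s -> sum_n u n <= s.
Proof.
  intros Hu Hs. apply (is_lim_seq_incr_compare (sum_n u) s Hs).
  intros m. rewrite sum_Sn. Rplus_norm. specialize (Hu (S m)). lra.
Qed.

(** Between two partial sums this is the triangle inequality; the limit is
    reached through an arbitrarily late partial sum. *)
Lemma Cmod_series_tail (u : nat -> C) (l : C) (s : R) (n : nat) :
  is_series (K := C_AbsRing) (V := C_NormedModule) u l ->
  is_series (fun k : nat => Cmod (u k)) s ->
  Cmod (l - sum_n u n)%C <= s - sum_n (fun k : nat => Cmod (u k)) n.
Proof.
  intros Hu Hs.
  assert (Hd : forall p : nat, Cmod (sum_n u (p + n) - sum_n u n)%C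
    <= sum_n (fun k : nat => Cmod (u k)) (p + n)
       - sum_n (fun k : nat => Cmod (u k)) n).
  { induction p as [|p IH]; cbn [Nat.add].
    - replace (sum_n u n - sum_n u n)%C with (RtoC 0) by Cring.
      rewrite Cmod_0. lra.
    - rewrite !sum_Sn. Rplus_norm.
      replace (plus (sum_n u (p + n)) (u (S (p + n))) - sum_n u n)%C
        with ((sum_n u (p + n) - sum_n u n) + u (S (p + n)))%C.
      2:{ change (plus (sum_n u (p + n)) (u (S (p + n))))
            with (sum_n u (p + n) + u (S (p + n)))%C. Cring. }
      eapply Rle_trans; [apply Cmod_triangle|]. lra. }
  apply le_epsilon. intros eps He.
  destruct (proj1 (is_series_C_eps u l) Hu eps He) as [N HN].
  specialize (HN (N + n)%nat ltac:(lia)). specialize (Hd N).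
  replace (l - sum_n u n)%C
    with ((sum_n u (N + n) - sum_n u n) + - (sum_n u (N + n) - l))%C by Cring.
  eapply Rle_trans; [apply Cmod_triangle|]. rewrite Cmod_opp.
  assert (Hs' : sum_n (fun k : nat => Cmod (u k)) (N + n) <= s).
  { apply sum_n_le_Rseries; [intros; apply Cmod_ge_0|exact Hs]. }
  lra.
Qed.

Lemma sum_n_le_R (u v : nat -> R) (n : nat) :
  (forall k : nat, u k <= v k) -> sum_n u n <= sum_n v n.
Proof.
  intros H. rewrite !sum_n_Reals. apply sum_Rle. intros k _. apply H.
Qed.

Lemma disk_abs_summable (c : nat -> C) (F : C -> C) (r : R) :
  has_power_series_on_disk c F -> 0 <= r < 1 ->
  ex_series (fun k : nat => Cmod (c k) * r ^ k).
Proof.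
  intros H Hr.
  apply (ex_series_ext (fun k : nat => Rabs (Cmod (c k) * r ^ k))).
  - intros k. apply Rabs_pos_eq.
    apply Rmult_le_pos; [apply Cmod_ge_0|apply pow_le; lra].
  - apply (CV_disk_inside (fun k => Cmod (c k))).
    apply Rbar_lt_CV_radius; [|lra]. eapply CV_radius_disk, H.
Qed.

Lemma disk_tail (c : nat -> C) (F : C -> C) (z : C) (n : nat) :
  has_power_series_on_disk c F -> in_disk z ->
  Cmod (F z - sum_n (fun k : nat => (c k * z ^ k)%C) n)%C
  <= Series (fun k : nat => Cmod (c k) * Cmod z ^ k)
     - sum_n (fun k : nat => Cmod (c k) * Cmod z ^ k) n.
Proof.
  intros H Hz.
  assert (E : forall k, Cmod (c k * z ^ k)%C = Cmod (c k) * Cmod z ^ k)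
    by (intros k; now rewrite Cmod_mult, Cmod_pow).
  rewrite <- (sum_n_ext _ _ n E).
  apply Cmod_series_tail.
  - apply is_pseries_C, H, Hz.
  - apply (is_series_ext (fun k : nat => Cmod (c k) * Cmod z ^ k)).
    { intros k. symmetry. apply E. }
    apply Series_correct. eapply disk_abs_summable; [exact H|].
    split; [apply Cmod_ge_0|exact Hz].
Qed.

(** The mean of |F|^2 over the circle of radius sqrt x, for F with coefficients
    [c]. *)
Definition mean_square (c : nat -> C) (x : R) : R :=
  PSeries (fun k : nat => Cmod (c k) ^ 2) x.

Lemma is_series_mean_square (c : nat -> C) (F : C -> C) (x : R) :
  has_power_series_on_disk c F -> 0 <= x < 1 ->
  is_series (fun k : nat => Cmod (c k) ^ 2 * x ^ k) (mean_square c x).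
Proof.
  intros H Hx. apply is_pseries_R, PSeries_correct, CV_radius_inside.
  apply Rbar_lt_CV_radius; [|exact Hx]. eapply CV_radius_disk_sqr, H.
Qed.

(** The comparison is made for the Taylor polynomials of degree n at the n + 1
    points of modulus sqrt x where Parseval's identity is exact.  Replacing F
    and G there by their Taylor polynomials costs a tail e(n) uniform on the
    circle, so squares change by at most 2 A e(n) + e(n)^2, which tends to 0. *)
Lemma mean_square_le (c d : nat -> C) (F G : C -> C) (x : R) :
  has_power_series_on_disk c F -> has_power_series_on_disk d G ->
  (forall z : C, in_disk z -> Cmod (G z) <= Cmod (F z)) ->
  0 <= x < 1 -> mean_square d x <= mean_square c x.
Proof.
  intros HF HG HFG Hx.
  set (r := sqrt x).
  assert (Hr0 : 0 <= r) by apply sqrt_pos.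
  assert (Hr1 : r < 1) by (rewrite <- sqrt_1; apply sqrt_lt_1; lra).
  assert (Hrx : forall k, (r ^ k) ^ 2 = x ^ k).
  { intros k. rewrite <- pow_mult, Nat.mul_comm, pow_mult. unfold r.
    rewrite pow2_sqrt; lra. }
  set (A := Series (fun k : nat => Cmod (c k) * r ^ k)).
  set (B := Series (fun k : nat => Cmod (d k) * r ^ k)).
  set (e := fun n : nat => (A - sum_n (fun k : nat => Cmod (c k) * r ^ k) n)
                           + (B - sum_n (fun k : nat => Cmod (d k) * r ^ k) n)).
  assert (HA : is_series (fun k : nat => Cmod (c k) * r ^ k) A)
    by (apply Series_correct; eapply disk_abs_summable; eauto).
  assert (HB : is_series (fun k : nat => Cmod (d k) * r ^ k) B)
    by (apply Series_correct; eapply disk_abs_summable; eauto).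
  assert (He : is_lim_seq e 0).
  { replace (Finite 0) with (Finite ((A - A) + (B - B))) by (f_equal; ring).
    apply is_lim_seq_plus'; apply is_lim_seq_minus';
      try apply is_lim_seq_const; [exact HA|exact HB]. }
  assert (Hlim : is_lim_seq (fun n => sum_n (fun k => Cmod (c k) ^ 2 * x ^ k) n
                             + (2 * A * e n + e n * e n)) (mean_square c x)).
  { replace (Finite (mean_square c x)) with
      (Finite (mean_square c x + (2 * A * 0 + 0 * 0))) by (f_equal; ring).
    apply is_lim_seq_plus'; [eapply is_series_mean_square; eauto|].
    apply is_lim_seq_plus'; apply is_lim_seq_mult'; trivial.
    apply is_lim_seq_const. }
  refine (is_lim_seq_le _ _ (mean_square d x) (mean_square c x) _
            (is_series_mean_square d G x HG Hx) Hlim).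
  intros n.
  set (w := root_of_unity n).
  assert (HN : 0 < INR (S n)) by (apply lt_0_INR; lia).
  assert (HP : forall q : nat -> C,
    sum_n (fun j : nat => Cmod (sum_n (fun k : nat => (q k * (r * w ^ j) ^ k)%C) n) ^ 2) n
    = INR (S n) * sum_n (fun k : nat => Cmod (q k) ^ 2 * x ^ k) n).
  { intros q.
    rewrite (sum_n_ext (fun k : nat => Cmod (q k) ^ 2 * x ^ k)
                       (fun k : nat => Cmod (q k * r ^ k)%C ^ 2)).
    2:{ intros k. rewrite Cmod_mult, Rpow_mult_distr, Cmod_pow, Cmod_R.
        rewrite (Rabs_pos_eq r Hr0), Hrx. reflexivity. }
    rewrite <- (finite_Parseval _ n n (le_n n)).
    apply sum_n_ext. intros j. f_equal. f_equal. apply sum_n_ext. intros k.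
    fold w. rewrite Cpow_mult_l. Cring. }
  apply (Rmult_le_reg_l (INR (S n)) _ _ HN).
  rewrite Rmult_plus_distr_l, <- !HP, <- sum_n_const.
  match goal with |- _ <= ?X + ?Y => change (X + Y) with (plus X Y) end.
  rewrite <- sum_n_plus. apply sum_n_le_R. intros j. Rplus_norm.
  assert (Hz : Cmod (r * w ^ j)%C = r).
  { rewrite Cmod_mult, Cmod_pow, Cmod_R, Rabs_pos_eq by exact Hr0.
    unfold w, root_of_unity. rewrite Cmod_cis, pow1. ring. }
  assert (Hd : in_disk (r * w ^ j)%C) by (unfold in_disk; rewrite Hz; exact Hr1).
  pose proof (disk_tail c F _ n HF Hd) as TF.
  pose proof (disk_tail d G _ n HG Hd) as TG.
  rewrite Hz in TF, TG. fold A in TF. fold B in TG.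
  pose proof (HFG _ Hd) as Hle.
  set (z := (r * w ^ j)%C) in *.
  set (P := sum_n (fun k : nat => (c k * z ^ k)%C) n) in *.
  set (Q := sum_n (fun k : nat => (d k * z ^ k)%C) n) in *.
  assert (HQ : Cmod Q <= Cmod (G z) + Cmod (G z - Q)%C).
  { replace Q with (G z + - (G z - Q))%C at 1 by Cring.
    eapply Rle_trans; [apply Cmod_triangle|]. rewrite Cmod_opp. lra. }
  assert (HPF : Cmod (F z) <= Cmod P + Cmod (F z - P)%C).
  { replace (F z) with (P + (F z - P))%C at 1 by Cring. apply Cmod_triangle. }
  assert (HQP : Cmod Q <= Cmod P + e n) by (unfold e; lra).
  assert (HPA : Cmod P <= A).
  { eapply Rle_trans; [apply Cmod_sum_n|].
    apply sum_n_le_Rseries; [intros; apply Cmod_ge_0|].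
    apply (is_series_ext _ _ _ (fun k => eq_sym
      (eq_trans (Cmod_mult (c k) (z ^ k)%C)
         (f_equal (Rmult (Cmod (c k))) (eq_trans (Cmod_pow z k) (f_equal (fun t => t ^ k) Hz)))))).
    exact HA. }
  assert (He0 : 0 <= e n).
  { unfold e.
    pose proof (Cmod_ge_0 (F z - P)%C). pose proof (Cmod_ge_0 (G z - Q)%C). lra. }
  pose proof (Cmod_ge_0 P). pose proof (Cmod_ge_0 Q).
  assert (Cmod Q ^ 2 <= (Cmod P + e n) ^ 2) by (apply pow_incr; lra).
  nra.
Qed.

(** * Coefficients of a function bounded by 1 *)

Lemma is_series_le_R (u v : nat -> R) (s t : R) :
  (forall k : nat, u k <= v k) -> is_series u s -> is_series v t -> s <= t.
Proof.
  intros H Hu Hv.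
  refine (is_lim_seq_le (sum_n u) (sum_n v) s t _ Hu Hv).
  intros n. apply sum_n_le_R, H.
Qed.

Lemma is_series_single (n : nat) (v : R) :
  is_series (fun k : nat => if Nat.eqb k n then v else 0) v.
Proof.
  change (is_lim_seq (sum_n (fun k : nat => if Nat.eqb k n then v else 0)) v).
  apply (is_lim_seq_ext_loc (fun _ => v)); [|apply is_lim_seq_const].
  assert (E : forall m : nat, sum_n (fun k : nat => if Nat.eqb k n then v else 0) m
               = if Nat.leb n m then v else 0).
  { induction m as [|m IH].
    - rewrite sum_O. destruct n; reflexivity.
    - rewrite sum_Sn, IH. Rplus_norm.
      destruct (Nat.leb_spec n m), (Nat.leb_spec n (S m)), (Nat.eqb_spec (S m) n);
        try lia; Rring. }
  exists n. intros m Hm. rewrite E. destruct (Nat.leb_spec n m); [easy|lia].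
Qed.

(** The coefficients of (al + be z^n) F(z), for F with coefficients [c]. *)
Definition mul_binomial (al be : C) (n : nat) (c : nat -> C) (k : nat) : C :=
  (al * c k + be * (if Nat.leb n k then c (k - n)%nat else 0))%C.

Lemma mul_binomial_series (al be : C) (n : nat) (c : nat -> C) (F : C -> C) :
  has_power_series_on_disk c F ->
  has_power_series_on_disk (mul_binomial al be n c)
    (fun z : C => ((al + be * z ^ n) * F z)%C).
Proof.
  intros H z Hz.
  assert (HE : forall k, plus (PS_scal (K := C_AbsRing) (V := C_NormedModule) al c k)
      (PS_scal (K := C_AbsRing) (V := C_NormedModule) be
         (PS_incr_n (K := C_AbsRing) (V := C_NormedModule) c n) k)
      = mul_binomial al be n c k).
  { intros k. unfold PS_scal, mul_binomial. rewrite PS_incr_n_simplify.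
    destruct (Compare_dec.le_lt_dec n k), (Nat.leb_spec n k); try lia; reflexivity. }
  apply (is_pseries_ext _ _ _ _ HE).
  replace ((al + be * z ^ n) * F z)%C with (al * F z + be * (z ^ n * F z))%C by ring.
  rewrite <- pow_n_Cpow.
  apply (is_pseries_plus (K := C_AbsRing) (V := C_NormedModule));
    apply (is_pseries_scal (K := C_AbsRing) (V := C_NormedModule));
    try apply Cmult_comm.
  - apply H, Hz.
  - apply (is_pseries_incr_n (K := C_AbsRing) (V := C_NormedModule) c n z (F z)).
    apply H, Hz.
Qed.

Definition const_one (k : nat) : C := if Nat.eqb k 0 then 1 else 0.

Lemma const_one_series : has_power_series_on_disk const_one (fun _ => RtoC 1).
Proof.
  intros z Hz. apply is_pseries_C, is_series_C_eps.
  assert (E : forall m, sum_n (fun k => const_one k * z ^ k)%C m = RtoC 1).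
  { induction m as [|m IH].
    - rewrite sum_O. unfold const_one. simpl. Cring.
    - rewrite sum_Sn, IH. unfold const_one. simpl Nat.eqb. cbv iota.
      change (plus (RtoC 1) (0 * z ^ S m)%C) with (1 + 0 * z ^ S m)%C. Cring. }
  intros eps He. exists 0%nat. intros n _. rewrite E.
  replace (RtoC 1 - RtoC 1)%C with (RtoC 0) by ring. rewrite Cmod_0. exact He.
Qed.

(** Both sides are continuous in x; the points 1 - 1/(m+1) tend to 1. *)
Lemma le_at_1 (A B C D : R) (n : nat) :
  (forall x : R, 0 <= x < 1 -> A + B * x ^ n <= C + D * x ^ n) -> A + B <= C + D.
Proof.
  intros H.
  assert (Hx : is_lim_seq (fun m : nat => 1 - / (INR m + 1)) 1).
  { replace (Finite 1) with (Finite (1 - 0)) by (f_equal; ring).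
    apply is_lim_seq_minus'; [apply is_lim_seq_const|].
    apply (is_lim_seq_ext (fun m => / INR (S m))).
    { intros m. now rewrite S_INR. }
    apply (is_lim_seq_incr_1 (fun m => / INR m)).
    replace (Finite 0) with (Rbar_inv p_infty) by reflexivity.
    apply is_lim_seq_inv; [apply is_lim_seq_INR|easy]. }
  assert (Hp : is_lim_seq (fun m : nat => (1 - / (INR m + 1)) ^ n) 1).
  { replace (Finite 1) with (Finite (1 ^ n)) by (now rewrite pow1).
    apply (is_lim_seq_continuous (fun x => x ^ n)); [|exact Hx].
    apply derivable_continuous_pt, derivable_pt_pow. }
  assert (Hl : forall P Q : R,
    is_lim_seq (fun m : nat => P + Q * (1 - / (INR m + 1)) ^ n) (P + Q)).
  { intros P Q. replace (Finite (P + Q)) with (Finite (P + Q * 1)) by (f_equal; ring).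
    apply is_lim_seq_plus'; [apply is_lim_seq_const|].
    apply is_lim_seq_mult'; [apply is_lim_seq_const|exact Hp]. }
  refine (is_lim_seq_le _ _ (A + B) (C + D) _ (Hl A B) (Hl C D)).
  intros m. apply H.
  assert (0 < INR m + 1) by (pose proof (pos_INR m); lra).
  assert (0 < / (INR m + 1)) by (apply Rinv_0_lt_compat; lra).
  assert (/ (INR m + 1) <= 1).
  { rewrite <- Rinv_1. apply Rinv_le_contravar; pose proof (pos_INR m); lra. }
  lra.
Qed.

(** Compare the mean squares of (al + be z^n) h and of al + be z^n; on the left
    keep only the coefficients of order 0 and n, then let x tend to 1. *)
Lemma multiplier_contraction (a : nat -> C) (h : C -> C) (al be : C) (n : nat) :
  has_power_series_on_disk a h -> (forall z : C, in_disk z -> Cmod (h z) <= 1) ->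
  (0 < n)%nat ->
  Cmod (al * a 0%nat)%C ^ 2 + Cmod (al * a n + be * a 0%nat)%C ^ 2
  <= Cmod al ^ 2 + Cmod be ^ 2.
Proof.
  intros Ha Hh Hn. apply (le_at_1 _ _ _ _ n). intros x Hx.
  assert (Hle : mean_square (mul_binomial al be n a) x
             <= mean_square (mul_binomial al be n const_one) x).
  { eapply mean_square_le; [apply mul_binomial_series, const_one_series
      |apply mul_binomial_series, Ha| |exact Hx].
    intros z Hz. simpl. rewrite !Cmod_mult, Cmod_1.
    apply Rmult_le_compat_l; [apply Cmod_ge_0|]. apply Hh, Hz. }
  (* the power series in x with the two coefficients p and q x^n that survive *)
  set (two := fun (p q : R) (k : nat) =>
     plus (if Nat.eqb k 0 then p else 0) (if Nat.eqb k n then q else 0)).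
  assert (Htwo : forall p q, is_series (two p q) (p + q)).
  { intros p q. apply (is_series_plus (V := R_NormedModule)); apply is_series_single. }
  apply Rle_trans with (mean_square (mul_binomial al be n a) x);
    [|eapply Rle_trans; [exact Hle|]].
  - refine (is_series_le_R _ _ _ _ _ (Htwo _ _)
      (is_series_mean_square _ _ x (mul_binomial_series al be n a h Ha) Hx)).
    intros k. unfold two, mul_binomial. Rplus_norm.
    assert (Hpos : forall c : C, 0 <= Cmod c ^ 2 * x ^ k).
    { intros c. apply Rmult_le_pos; [apply pow2_ge_0|apply pow_le; lra]. }
    destruct (Nat.eqb_spec k 0) as [->|Hk].
    + destruct (Nat.eqb_spec 0 n); [lia|]. destruct (Nat.leb_spec n 0); [lia|].
      replace (al * a 0%nat + be * 0)%C with (al * a 0%nat)%C by ring.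
      simpl pow at 3. lra.
    + destruct (Nat.eqb_spec k n) as [->|_].
      * rewrite Nat.leb_refl, Nat.sub_diag. lra.
      * rewrite Rplus_0_l. apply Hpos.
  - refine (is_series_le_R _ _ _ _ _
      (is_series_mean_square _ _ x
         (mul_binomial_series al be n _ _ const_one_series) Hx) (Htwo _ _)).
    intros k. unfold two, mul_binomial, const_one. Rplus_norm.
    destruct (Nat.eqb_spec k 0) as [->|Hk].
    + destruct (Nat.eqb_spec 0 n); [lia|]. destruct (Nat.leb_spec n 0); [lia|].
      replace (al * 1 + be * 0)%C with al by ring. simpl pow at 2. lra.
    + destruct (Nat.eqb_spec k n) as [->|Hkn].
      * rewrite Nat.leb_refl, Nat.sub_diag. simpl Nat.eqb. cbv iota.
        replace (al * 0 + be * 1)%C with be by ring. lra.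
      * destruct (Nat.leb_spec n k).
        -- destruct (Nat.eqb_spec (k - n) 0); [lia|].
           replace (al * 0 + be * 0)%C with (RtoC 0) by ring. rewrite Cmod_0. lra.
        -- replace (al * 0 + be * 0)%C with (RtoC 0) by ring. rewrite Cmod_0. lra.
Qed.

(** With al = 1 - A^2 and be = conj(a_0) a_n the coefficient
    al a_n + be a_0 is a_n itself, and the contraction inequality reads
    (1 - A^2) |a_n|^2 <= (1 - A^2)^3.  The choice al = 1, be = 0 supplies A <= 1
    and settles the case A = 1. *)
Lemma bounded_coef_le (a : nat -> C) (h : C -> C) (n : nat) :
  has_power_series_on_disk a h -> (forall z : C, in_disk z -> Cmod (h z) <= 1) ->
  (0 < n)%nat ->
  Cmod (a 0%nat) <= 1 /\ Cmod (a n) <= 1 - Cmod (a 0%nat) ^ 2.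
Proof.
  intros Ha Hh Hn.
  pose proof (multiplier_contraction a h 1 0 n Ha Hh Hn) as H1.
  replace (1 * a 0%nat)%C with (a 0%nat) in H1 by ring.
  replace (1 * a n + 0 * a 0%nat)%C with (a n) in H1 by ring.
  rewrite Cmod_1, Cmod_0 in H1.
  set (A := Cmod (a 0%nat)) in *.
  pose proof (multiplier_contraction a h (1 - A ^ 2) (Cconj (a 0%nat) * a n) n Ha Hh Hn)
    as H2.
  replace ((1 - A ^ 2) * a n + Cconj (a 0%nat) * a n * a 0%nat)%C with (a n) in H2.
  2:{ replace ((A ^ 2)%C) with (a 0%nat * Cconj (a 0%nat))%C.
      - ring.
      - rewrite <- RtoC_pow. symmetry. apply Cmod2_conj. }
  rewrite !Cmod_mult, Cmod_conj in H2. fold A in H2.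
  replace (Cmod (1 - A ^ 2)%C) with (Rabs (1 - A ^ 2)) in H2.
  2:{ rewrite <- Cmod_R, RtoC_minus, RtoC_pow. reflexivity. }
  assert (HA0 : 0 <= A) by apply Cmod_ge_0.
  pose proof (Cmod_ge_0 (a n)) as Hp. set (p := Cmod (a n)) in *.
  assert (HA1 : A <= 1) by nra.
  split; [exact HA1|].
  rewrite Rabs_pos_eq in H2 by nra.
  destruct (Req_dec A 1) as [E|NE].
  - rewrite E in *. nra.
  - assert (0 < 1 - A ^ 2) by nra.
    set (D := 1 - A ^ 2) in *.
    assert (HD : D * p ^ 2 <= D * D ^ 2) by (unfold D in *; nra).
    apply Rmult_le_reg_l in HD; [|assumption].
    nra.
Qed.

(** * Termwise differentiation of a complex power series *)

Lemma is_series_C_of_Re_Im (u : nat -> C) (l : C) :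
  is_series (fun k : nat => Re (u k)) (Re l) ->
  is_series (fun k : nat => Im (u k)) (Im l) ->
  is_series (K := C_AbsRing) (V := C_NormedModule) u l.
Proof.
  intros HR HI.
  assert (HE : forall (w : nat -> R) (s : R), is_series w s -> forall eps, 0 < eps ->
     exists N : nat, forall n, (N <= n)%nat -> Rabs (sum_n w n - s) < eps).
  { intros w s Hw eps He.
    exact (proj2 (is_lim_seq_spec (sum_n w) s) Hw (mkposreal eps He)). }
  apply is_series_C_eps. intros eps He.
  destruct (HE _ _ HR (eps / 2) ltac:(lra)) as [N1 H1].
  destruct (HE _ _ HI (eps / 2) ltac:(lra)) as [N2 H2].
  exists (N1 + N2)%nat. intros n Hn.
  specialize (H1 n ltac:(lia)). specialize (H2 n ltac:(lia)).
  rewrite <- Re_sum_n in H1. rewrite <- Im_sum_n in H2.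
  set (w := sum_n u n) in *.
  change (Re w - Re l) with (Re (w - l)%C) in H1.
  change (Im w - Im l) with (Im (w - l)%C) in H2.
  set (v := (w - l)%C) in *.
  pose proof (Cmod2_alt v) as Hv. pose proof (Cmod_ge_0 v).
  pose proof (Rabs_pos (Re v)). pose proof (Rabs_pos (Im v)).
  rewrite <- (pow2_abs (Re v)), <- (pow2_abs (Im v)) in Hv.
  nra.
Qed.

Lemma is_series_Re (u : nat -> C) (l : C) :
  is_series (K := C_AbsRing) (V := C_NormedModule) u l ->
  is_series (fun k : nat => Re (u k)) (Re l).
Proof.
  intros H. change (is_lim_seq (sum_n (fun k : nat => Re (u k))) (Re l)).
  apply is_lim_seq_spec. intros [eps He]. simpl.
  destruct (proj1 (is_series_C_eps u l) H eps He) as [N HN].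
  exists N. intros n Hn. rewrite <- Re_sum_n.
  change (Re (sum_n u n) - Re l) with (Re (sum_n u n - l)%C).
  eapply Rle_lt_trans; [apply re_le_Cmod|]. apply HN, Hn.
Qed.

(** Every real functional Re (v * _) of h is followed along the ray through [u];
    this turns complex differentiability into an ordinary real derivative. *)
Lemma is_derive_C_ray (h : C -> C) (u v l : C) (x : R) :
  is_derive (K := C_AbsRing) (V := C_NormedModule) h (x * u)%C l ->
  is_derive (fun t : R => Re (v * h (t * u))%C) x (Re (v * (u * l))%C).
Proof.
  intros [_ H]. apply is_derive_Reals. intros eps He.
  set (M := Cmod v * Cmod u + 1).
  assert (HM : 0 < M).
  { unfold M. pose proof (Cmod_ge_0 u). pose proof (Cmod_ge_0 v). nra. }
  assert (He' : 0 < eps / M) by (apply Rdiv_lt_0_compat; lra).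
  specialize (H (x * u)%C (fun P HP => HP) (mkposreal _ He')).
  destruct H as [[d Hd] H].
  assert (Hd' : 0 < d / (Cmod u + 1)).
  { apply Rdiv_lt_0_compat; [exact Hd|]. pose proof (Cmod_ge_0 u). lra. }
  exists (mkposreal _ Hd'). intros t Ht0 Ht. cbn [pos] in Ht.
  change (Rabs ((Re (v * h ((x + t)%R * u))%C - Re (v * h (x * u))%C) / t
                - Re (v * (u * l))%C) < eps).
  set (y := ((x + t)%R * u)%C).
  assert (Hy : (y - x * u)%C = (t * u)%C).
  { unfold y. rewrite RtoC_plus. ring. }
  assert (Hb : Cmod (y - x * u)%C < d).
  { rewrite Hy, Cmod_mult, Cmod_R.
    pose proof (Cmod_ge_0 u). pose proof (Rabs_pos t).
    apply Rlt_div_r in Ht; [|lra]. nra. }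
  specialize (H y Hb).
  change (Cmod ((h y - h (x * u)) - (y - x * u) * l)%C
            <= eps / M * Cmod (y - x * u)%C) in H.
  rewrite Hy, (Cmod_mult t u), Cmod_R in H.
  set (E := ((h y - h (x * u)) - t * u * l)%C) in *.
  fold y.
  replace ((Re (v * h y)%C - Re (v * h (x * u))%C) / t - Re (v * (u * l))%C)
    with (Re (v * E)%C / t).
  2:{ unfold E. destruct v, u, l, (h y), (h (x * (r1, r2))%C). simpl. field. exact Ht0. }
  unfold Rdiv. rewrite Rabs_mult, Rabs_inv.
  assert (HT : 0 < Rabs t) by (apply Rabs_pos_lt; exact Ht0).
  apply (Rmult_lt_reg_r (Rabs t)); [exact HT|].
  rewrite Rmult_assoc, Rinv_l, Rmult_1_r by lra.
  eapply Rle_lt_trans; [apply re_le_Cmod|]. rewrite Cmod_mult.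
  apply Rle_lt_trans with (Cmod v * (eps / M * (Rabs t * Cmod u))).
  { apply Rmult_le_compat_l; [apply Cmod_ge_0|exact H]. }
  replace (Cmod v * (eps / M * (Rabs t * Cmod u)))
    with (eps * Rabs t * ((Cmod v * Cmod u) / M)) by (field; lra).
  assert (Cmod v * Cmod u / M < 1) by (apply Rlt_div_l; unfold M in *; lra).
  assert (0 < eps * Rabs t) by nra. nra.
Qed.

Definition C_PS_derive (a : nat -> C) (k : nat) : C := (INR (S k) * a (S k))%C.

Lemma CV_radius_Re_ray (a : nat -> C) (h : C -> C) (u v : C) :
  has_power_series_on_disk a h -> Cmod u = 1 ->
  Rbar_le 1 (CV_radius (fun k : nat => Re (v * (a k * u ^ k))%C)).
Proof.
  intros H Hu. apply CV_radius_ge_1. intros r Hr.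
  destruct (disk_coef_bound a h r H Hr) as [M HM].
  exists (Cmod v * M). intros n. rewrite Rabs_mult.
  assert (Hn : 0 <= r ^ n) by (apply pow_le; lra).
  rewrite (Rabs_pos_eq (r ^ n) Hn).
  eapply Rle_trans; [apply Rmult_le_compat_r; [exact Hn|apply re_le_Cmod]|].
  rewrite !Cmod_mult, Cmod_pow, Hu, pow1, Rmult_1_r, Rmult_assoc.
  apply Rmult_le_compat_l; [apply Cmod_ge_0|apply HM].
Qed.

Lemma ray_pseries (a : nat -> C) (h : C -> C) (u v : C) (x : R) :
  has_power_series_on_disk a h -> Cmod u = 1 -> Rabs x < 1 ->
  is_pseries (fun k : nat => Re (v * (a k * u ^ k))%C) x (Re (v * h (x * u))%C).
Proof.
  intros H Hu Hx. apply is_pseries_R.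
  assert (Hd : in_disk (x * u)%C)
    by (unfold in_disk; rewrite Cmod_mult, Cmod_R, Hu; lra).
  pose proof (proj1 (is_pseries_C _ _ _) (H _ Hd)) as Hs.
  apply (is_series_scal (K := C_AbsRing) (V := C_NormedModule) v) in Hs.
  apply is_series_Re in Hs.
  refine (is_series_ext _ _ _ _ Hs). intros k.
  change (Re (v * (a k * (x * u) ^ k))%C = Re (v * (a k * u ^ k))%C * x ^ k).
  rewrite Cpow_mult_l, <- RtoC_pow.
  destruct v, (a k), (u ^ k)%C. simpl. ring.
Qed.

(** Along a ray, Re (v h) is a real power series, which may be differentiated
    term by term; by uniqueness of the real derivative the result is
    Re (v u h'). *)
Lemma ray_derivative (a : nat -> C) (h : C -> C) (u v l : C) (x : R) :
  has_power_series_on_disk a h -> Cmod u = 1 -> 0 <= x < 1 ->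
  is_derive (K := C_AbsRing) (V := C_NormedModule) h (x * u)%C l ->
  is_series (fun k : nat => Re (v * u * (C_PS_derive a k * (x * u) ^ k))%C)
            (Re (v * u * l)%C).
Proof.
  intros H Hu Hx Hl.
  set (A := fun k : nat => Re (v * (a k * u ^ k))%C).
  assert (HA : Rbar_lt (Rabs x) (CV_radius A)).
  { apply Rbar_lt_CV_radius; [eapply CV_radius_Re_ray; eauto|exact Hx]. }
  assert (HD : PSeries (PS_derive A) x = Re (v * u * l)%C).
  { apply (eq_trans (eq_sym (Derive_PSeries A x HA))). apply is_derive_unique.
    apply (is_derive_ext_loc (fun t : R => Re (v * h (t * u))%C)).
    - assert (Hp : 0 < 1 - x) by lra. exists (mkposreal _ Hp). intros t Ht.
      change (Rabs (t - x) < 1 - x) in Ht. symmetry.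
      apply is_pseries_unique, (ray_pseries a h u v t H Hu).
      apply Rabs_def1; apply Rabs_def2 in Ht; lra.
    - rewrite <- Cmult_assoc. apply is_derive_C_ray, Hl. }
  rewrite <- HD.
  assert (HS : is_pseries (PS_derive A) x (PSeries (PS_derive A) x)).
  { apply PSeries_correct, CV_radius_inside. rewrite CV_radius_derive. exact HA. }
  apply is_pseries_R in HS. refine (is_series_ext _ _ _ _ HS).
  intros k. unfold PS_derive, A, C_PS_derive.
  rewrite Cpow_mult_l, <- RtoC_pow, Cpow_S.
  destruct v, (a (S k)), u, ((r1, r2) ^ k)%C. simpl. ring.
Qed.

Lemma polar_form (z : C) : exists (x : R) (u : C),
  0 <= x /\ Cmod u = 1 /\ z = (x * u)%C.
Proof.
  destruct (Req_dec (Cmod z) 0) as [E|NE].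
  - exists 0, (RtoC 1). split; [lra|]. split; [apply Cmod_1|].
    apply Cmod_eq_0 in E. rewrite E. ring.
  - pose proof (Cmod_ge_0 z).
    assert (HC : RtoC (Cmod z) <> 0) by (intros HC; apply RtoC_inj in HC; lra).
    exists (Cmod z), (z / Cmod z)%C. split; [lra|]. split.
    + rewrite Cmod_div by exact HC. rewrite Cmod_R, Rabs_pos_eq by lra. field; lra.
    + field. exact HC.
Qed.

(** In polar form z = x u, the choices v = conj u and v = - i conj u in
    [ray_derivative] cancel the factor u and recover the real and imaginary
    parts of the differentiated series. *)
Lemma C_derive_pseries (a : nat -> C) (h : C -> C) :
  has_power_series_on_disk a h -> analytic_on_disk h ->
  has_power_series_on_disk (C_PS_derive a) (C_derive h).
Proof.
  intros H Han z Hz. apply is_pseries_C.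
  pose proof (C_derive_correct h z z (Han z Hz)) as Hd.
  destruct (polar_form z) as (x & u & Hx & Hu & ->).
  assert (Hx1 : 0 <= x < 1).
  { split; [exact Hx|]. unfold in_disk in Hz.
    rewrite Cmod_mult, Cmod_R, Hu, Rabs_pos_eq in Hz; lra. }
  assert (Huu : (Cconj u * u)%C = 1).
  { rewrite Cmult_comm, <- Cmod2_conj, Hu. simpl. f_equal. ring. }
  apply is_series_C_of_Re_Im.
  - pose proof (ray_derivative a h u (Cconj u) _ x H Hu Hx1 Hd) as HR.
    rewrite Huu, Cmult_1_l in HR.
    refine (is_series_ext _ _ _ _ HR). intros k. now rewrite Cmult_1_l.
  - pose proof (ray_derivative a h u (- Ci * Cconj u) _ x H Hu Hx1 Hd) as HR.
    rewrite <- (Cmult_assoc (- Ci)), Huu in HR.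
    assert (E : forall w : C, Re (- Ci * 1 * w)%C = Im w)
      by (intros [p q]; simpl; ring).
    rewrite E in HR. refine (is_series_ext _ _ _ _ HR). intros k. apply E.
Qed.

(** * The inequality for r <= 1/5 *)

Lemma PSeries_ge_0_of_derive (u : nat -> R) :
  Rbar_le 1 (CV_radius u) -> 0 <= u 0%nat ->
  (forall x : R, 0 < x < 1 -> 0 <= PSeries (PS_derive u) x) ->
  forall x : R, 0 <= x < 1 -> 0 <= PSeries u x.
Proof.
  intros Hcv Hu0 Hd x Hx.
  destruct (Req_dec x 0) as [->|Hx0]; [rewrite PSeries_0; exact Hu0|].
  destruct (MVT_cor2 (PSeries u) (PSeries (PS_derive u)) 0 x ltac:(lra))
    as (c & Hc & Hcx).
  { intros c Hc. apply is_derive_Reals, is_derive_PSeries.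
    apply Rbar_lt_CV_radius; [exact Hcv|lra]. }
  rewrite PSeries_0 in Hc. specialize (Hd c ltac:(lra)). nra.
Qed.

(** With u_k = |a_k|^2 - |b_k|^2 for k >= 1, u_0 = 0, and D the sum of u_k x^k,
    the coefficients of (x D')' are (k+1)^2 u_(k+1), those of the difference of
    the mean squares of the derivatives.  Two applications of the mean value
    theorem lead from (x D')' >= 0 to x D' >= 0 and to D >= 0. *)
Lemma tail_square_le_of_derive (a b : nat -> C) (h g : C -> C) :
  has_power_series_on_disk a h -> has_power_series_on_disk b g ->
  (forall x : R, 0 < x < 1 ->
     ex_pseries (fun k => Cmod (C_PS_derive a k) ^ 2) x /\
     ex_pseries (fun k => Cmod (C_PS_derive b k) ^ 2) x /\
     mean_square (C_PS_derive b) x <= mean_square (C_PS_derive a) x) ->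
  forall x : R, 0 <= x < 1 ->
    Series (fun k : nat => Cmod (b (S k)) ^ 2 * x ^ S k)
    <= Series (fun k : nat => Cmod (a (S k)) ^ 2 * x ^ S k).
Proof.
  intros Ha Hb Hd.
  set (A := fun k : nat => Cmod (a k) ^ 2).
  set (B := fun k : nat => Cmod (b k) ^ 2).
  set (u := PS_incr_1 (PS_decr_1 (PS_minus A B))).
  assert (HcA : Rbar_le 1 (CV_radius A)) by (eapply CV_radius_disk_sqr, Ha).
  assert (HcB : Rbar_le 1 (CV_radius B)) by (eapply CV_radius_disk_sqr, Hb).
  assert (Hcu : Rbar_le 1 (CV_radius u)).
  { unfold u. rewrite CV_radius_incr_1, CV_radius_decr_1.
    eapply Rbar_le_trans; [|apply (CV_radius_plus A (PS_opp B))].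
    rewrite CV_radius_opp. apply Rbar_min_case; assumption. }
  assert (Hdu : forall x : R, 0 < x < 1 -> 0 <= PSeries (PS_derive u) x).
  { intros x Hx.
    (* [PS_incr_1 (PS_derive u)] is the series of x D' *)
    assert (H : 0 <= PSeries (PS_incr_1 (PS_derive u)) x).
    { apply PSeries_ge_0_of_derive; [|apply Rle_refl| |lra].
      - now rewrite CV_radius_incr_1, CV_radius_derive.
      - intros y Hy. destruct (Hd y Hy) as (H1 & H2 & H3).
        rewrite (PSeries_ext _ (PS_minus (fun k => Cmod (C_PS_derive a k) ^ 2)
                                  (fun k => Cmod (C_PS_derive b k) ^ 2))).
        + rewrite PSeries_minus by assumption. unfold mean_square in H3. lra.
        + intros k.
          change (INR (S k) * (INR (S k) * (A (S k) + - B (S k)))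
            = Cmod (INR (S k) * a (S k))%C ^ 2 + - Cmod (INR (S k) * b (S k))%C ^ 2).
          rewrite !Cmod_mult, Cmod_R, Rabs_pos_eq by apply pos_INR.
          unfold A, B. ring. }
    rewrite PSeries_incr_1 in H.
    apply (Rmult_le_reg_l x); [lra|]. rewrite Rmult_0_r. exact H. }
  intros x Hx.
  pose proof (PSeries_ge_0_of_derive u Hcu (Rle_refl 0) Hdu x Hx) as H.
  assert (HsA : is_series (fun k => A k * x ^ k) (mean_square a x))
    by (eapply is_series_mean_square; eauto).
  assert (HsB : is_series (fun k => B k * x ^ k) (mean_square b x))
    by (eapply is_series_mean_square; eauto).
  assert (HeA : ex_series (fun k => A (S k) * x ^ S k))
    by (apply (ex_series_incr_1 (fun k => A k * x ^ k)); eexists; exact HsA).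
  assert (HeB : ex_series (fun k => B (S k) * x ^ S k))
    by (apply (ex_series_incr_1 (fun k => B k * x ^ k)); eexists; exact HsB).
  apply Rminus_le_0.
  change (0 <= Series (fun k => A (S k) * x ^ S k) - Series (fun k => B (S k) * x ^ S k)).
  rewrite <- Series_minus by assumption.
  replace (Series (fun k => A (S k) * x ^ S k - B (S k) * x ^ S k)) with (PSeries u x);
    [exact H|].
  unfold u. rewrite PSeries_incr_1. unfold PSeries. rewrite <- Series_scal_l.
  apply Series_ext. intros k.
  change (x * ((A (S k) + - B (S k)) * x ^ k) = A (S k) * x ^ S k - B (S k) * x ^ S k).
  simpl pow. ring.
Qed.

Lemma is_series_geom_tail (r : R) :
  0 <= r < 1 -> is_series (fun k : nat => r ^ S k) (r / (1 - r)).
Proof.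
  intros Hr. apply (is_series_scal (K := R_AbsRing) (V := R_NormedModule) r).
  apply is_series_geom. rewrite Rabs_pos_eq; lra.
Qed.

Lemma Series_le_geom_tail (w : nat -> R) (L r : R) :
  0 <= r < 1 -> (forall k : nat, w k <= L) ->
  ex_series (fun k : nat => w k * r ^ S k) ->
  Series (fun k : nat => w k * r ^ S k) <= L * (r / (1 - r)).
Proof.
  intros Hr Hw Hex.
  refine (is_series_le_R _ (fun k : nat => L * r ^ S k) _ _ _ (Series_correct _ Hex)
    (is_series_scal (K := R_AbsRing) (V := R_NormedModule) L _ _
       (is_series_geom_tail r Hr))).
  intros k. apply Rmult_le_compat_r; [apply pow_le; lra|apply Hw].
Qed.

(** Cauchy-Schwarz for the weights r^(k+1), in the form
    w <= w^2 / (2 mu) + mu / 2.  The best mu is L, which may be 0, so mu > 0 is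
    taken slightly larger. *)
Lemma Series_le_of_square (w : nat -> R) (L r : R) :
  0 <= r < 1 -> 0 <= L ->
  ex_series (fun k : nat => w k * r ^ S k) ->
  ex_series (fun k : nat => w k ^ 2 * r ^ S k) ->
  Series (fun k : nat => w k ^ 2 * r ^ S k) <= L ^ 2 * (r / (1 - r)) ->
  Series (fun k : nat => w k * r ^ S k) <= L * (r / (1 - r)).
Proof.
  intros Hr HL Hex Hex2 H2. set (t := r / (1 - r)) in *.
  assert (Ht : 0 <= t) by (apply Rdiv_le_0_compat; lra).
  assert (Hmu : forall mu : R, L <= mu -> 0 < mu ->
     Series (fun k : nat => w k * r ^ S k) <= mu * t).
  { intros mu HLm Hm.
    set (s2 := Series (fun k : nat => w k ^ 2 * r ^ S k)) in *.
    assert (Hs : is_series (fun k => plus (/ (2 * mu) * (w k ^ 2 * r ^ S k))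
                                          (mu / 2 * r ^ S k))
                   (plus (/ (2 * mu) * s2) (mu / 2 * t))).
    { apply (is_series_plus (V := R_NormedModule));
        apply (is_series_scal (K := R_AbsRing) (V := R_NormedModule)).
      - apply Series_correct, Hex2.
      - apply is_series_geom_tail, Hr. }
    apply Rle_trans with (/ (2 * mu) * s2 + mu / 2 * t).
    - refine (is_series_le_R _ _ _ _ _ (Series_correct _ Hex) Hs).
      intros k. Rplus_norm.
      assert (Hk : 0 <= r ^ S k) by (apply pow_le; lra).
      replace (/ (2 * mu) * (w k ^ 2 * r ^ S k) + mu / 2 * r ^ S k)
        with ((w k + (w k - mu) ^ 2 / (2 * mu)) * r ^ S k) by (field; lra).
      apply Rmult_le_compat_r; [exact Hk|].
      assert (0 <= (w k - mu) ^ 2 / (2 * mu)).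
      { apply Rdiv_le_0_compat; [apply pow2_ge_0|lra]. }
      lra.
    - apply Rle_trans with (/ (2 * mu) * (mu ^ 2 * t) + mu / 2 * t).
      + apply Rplus_le_compat_r, Rmult_le_compat_l.
        * left. apply Rinv_0_lt_compat. lra.
        * eapply Rle_trans; [exact H2|]. apply Rmult_le_compat_r; [exact Ht|].
          apply pow_incr. lra.
      + right. field. lra. }
  apply le_epsilon. intros eps He.
  (* mu exceeds L by so little that (mu - L) t < eps *)
  eapply Rle_trans; [apply (Hmu (L + eps / (t + 1)))|].
  - assert (0 < eps / (t + 1)) by (apply Rdiv_lt_0_compat; lra). lra.
  - assert (0 < eps / (t + 1)) by (apply Rdiv_lt_0_compat; lra). lra.
  - assert (E : eps = eps / (t + 1) * (t + 1)) by (field; lra).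
    assert (0 < eps / (t + 1)) by (apply Rdiv_lt_0_compat; lra). nra.
Qed.

Lemma admissible_le_1 (f h g : C -> C) (a b : nat -> C) :
  admissible f h g a b -> forall z : C, in_disk z -> Cmod (h z) <= 1.
Proof.
  intros H z Hz.
  assert (E : Rbar_le (Cmod (h z)) (sup_norm_disk h)).
  { apply (proj1 (Lub_Rbar_correct _)). now exists z. }
  rewrite (adm_h_norm _ _ _ _ _ H) in E. exact E.
Qed.

(** The bounds L t for the sums of |a_k| r^k and |b_k| r^k and for |h(z) - a_0|
    are combined; at t = 1/4 the total is A + L/2 + (L/4)^2. *)
Lemma bohr_inequality (f h g : C -> C) (a b : nat -> C) (z : C) (r : R) :
  admissible f h g a b -> in_disk z -> Cmod z = r -> r <= 1 / 5 ->
  ex_series (fun k : nat => bohr_term a b r (S k)) /\ bohr_sum h a b r z <= 1.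
Proof.
  intros H Hz Hzr Hr5.
  pose proof (admissible_le_1 _ _ _ _ _ H) as Hh1.
  destruct H as [_ Hha Hga Ha Hb Hb0 _ Hdil].
  assert (Hr : 0 <= r < 1) by (pose proof (Cmod_ge_0 z); lra).
  pose proof (disk_abs_summable a h r Ha Hr) as Hea.
  pose proof (disk_abs_summable b g r Hb Hr) as Heb.
  pose proof (proj1 (ex_series_incr_1 _) Hea) as Hea1.
  pose proof (proj1 (ex_series_incr_1 _) Heb) as Heb1.
  pose proof (ex_intro _ _ (is_series_mean_square a h r Ha Hr) : ex_series _) as Hea2.
  pose proof (ex_intro _ _ (is_series_mean_square b g r Hb Hr) : ex_series _) as Heb2.
  apply (proj1 (ex_series_incr_1 _)) in Hea2.
  apply (proj1 (ex_series_incr_1 _)) in Heb2.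
  cbv beta in Hea1, Heb1, Hea2, Heb2.
  assert (HE : forall k : nat, bohr_term a b r (S k)
     = Cmod (a (S k)) * r ^ S k + Cmod (b (S k)) * r ^ S k)
    by (intros k; unfold bohr_term; ring).
  split.
  { apply (ex_series_ext (V := R_NormedModule) _ _ (fun k => eq_sym (HE k))).
    now apply (ex_series_plus (V := R_NormedModule)). }
  set (A := Cmod (a 0%nat)).
  assert (HA0 : 0 <= A) by apply Cmod_ge_0.
  assert (HA1 : A <= 1) by (apply (bounded_coef_le a h 1 Ha Hh1); lia).
  set (L := 1 - A ^ 2).
  assert (HL : 0 <= L) by (unfold L; nra).
  assert (HaL : forall k : nat, Cmod (a (S k)) <= L)
    by (intros k; apply (bounded_coef_le a h (S k) Ha Hh1); lia).
  set (t := r / (1 - r)).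
  assert (Ht0 : 0 <= t) by (apply Rdiv_le_0_compat; lra).
  assert (Ht4 : t <= 1 / 4) by (apply Rle_div_l; lra).
  assert (HSa : Series (fun k : nat => Cmod (a (S k)) * r ^ S k) <= L * t)
    by (apply Series_le_geom_tail; assumption).
  assert (HSa2 : Series (fun k : nat => Cmod (a (S k)) ^ 2 * r ^ S k) <= L ^ 2 * t).
  { apply (Series_le_geom_tail (fun k => Cmod (a (S k)) ^ 2)); try assumption.
    intros k. apply pow_incr. split; [apply Cmod_ge_0|apply HaL]. }
  pose proof (C_derive_pseries a h Ha Hha) as Hda.
  pose proof (C_derive_pseries b g Hb Hga) as Hdb.
  assert (HSb : Series (fun k : nat => Cmod (b (S k)) * r ^ S k) <= L * t).
  { apply (Series_le_of_square (fun k => Cmod (b (S k)))); try assumption.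
    eapply Rle_trans; [|exact HSa2].
    apply (tail_square_le_of_derive a b h g Ha Hb); [|exact Hr].
    intros x Hx. assert (Hx' : 0 <= x < 1) by lra. repeat split.
    - eexists. apply is_pseries_R. eapply is_series_mean_square; eauto.
    - eexists. apply is_pseries_R. eapply is_series_mean_square; eauto.
    - exact (mean_square_le _ _ _ _ x Hda Hdb Hdil Hx'). }
  assert (Hha0 : Cmod (h z - a 0%nat)%C <= L * t).
  { pose proof (disk_tail a h z 0 Ha Hz) as HT. rewrite !sum_O, Hzr in HT.
    rewrite (Series_incr_1 _ Hea) in HT.
    replace (a 0%nat * z ^ 0)%C with (a 0%nat) in HT by (simpl; ring).
    lra. }
  unfold bohr_sum. fold A.
  rewrite (Series_ext _ _ HE), Series_plus by assumption.
  pose proof (Cmod_ge_0 (h z - a 0%nat)%C) as Hc0.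
  assert (HLt : L * t <= L / 4) by nra.
  assert (Cmod (h z - a 0%nat)%C ^ 2 <= (L / 4) ^ 2) by (apply pow_incr; lra).
  assert (A + L / 2 + (L / 4) ^ 2 <= 1).
  { replace (A + L / 2 + (L / 4) ^ 2)
      with (1 - (1 - A) ^ 2 * (1 / 2 - (1 + A) ^ 2 / 16)) by (unfold L; field).
    assert (0 <= (1 - A) ^ 2) by apply pow2_ge_0.
    assert (0 <= 1 / 2 - (1 + A) ^ 2 / 16) by nra.
    nra. }
  lra.
Qed.

(** * Sharpness: the Moebius maps *)

Lemma geometric_denominator (a : R) (z : C) :
  0 <= a < 1 -> in_disk z -> 1 - a <= Cmod (1 - a * z)%C.
Proof.
  intros Ha Hz. unfold in_disk in Hz.
  pose proof (Cmod_triangle (1 - a * z)%C (a * z)%C) as H.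
  replace (1 - a * z + a * z)%C with (RtoC 1) in H by ring.
  rewrite Cmod_1, Cmod_mult, Cmod_R, Rabs_pos_eq in H by lra.
  pose proof (Cmod_ge_0 z). nra.
Qed.

Lemma geometric_denominator_neq_0 (a : R) (z : C) :
  0 <= a < 1 -> in_disk z -> (1 - a * z)%C <> 0.
Proof.
  intros Ha Hz H. pose proof (geometric_denominator a z Ha Hz) as Hm.
  rewrite H, Cmod_0 in Hm. lra.
Qed.

Lemma geometric_series (a : R) :
  0 <= a < 1 ->
  has_power_series_on_disk (fun k : nat => RtoC (a ^ k)) (fun z : C => (/ (1 - a * z))%C).
Proof.
  intros Ha z Hz. apply is_pseries_C, is_series_C_eps. intros eps He.
  pose proof (geometric_denominator a z Ha Hz) as Hm.
  pose proof (geometric_denominator_neq_0 a z Ha Hz) as Hne.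
  assert (Haz : Rabs (Cmod (a * z)%C) < 1).
  { rewrite Rabs_pos_eq by apply Cmod_ge_0.
    rewrite Cmod_mult, Cmod_R, Rabs_pos_eq by lra.
    unfold in_disk in Hz. pose proof (Cmod_ge_0 z). nra. }
  assert (Hp : 0 < eps * (1 - a)) by nra.
  destruct (proj2 (is_lim_seq_spec _ _) (is_lim_seq_geom _ Haz) (mkposreal _ Hp))
    as [N HN].
  exists N. intros n Hn. specialize (HN (S n) ltac:(lia)). cbn [pos] in HN.
  rewrite Rminus_0_r, Rabs_pos_eq in HN by apply pow_le, Cmod_ge_0.
  rewrite (sum_n_ext _ (fun k : nat => ((a * z) ^ k)%C)).
  2:{ intros k. rewrite Cpow_mult_l, <- RtoC_pow. reflexivity. }
  pose proof (Cgeom_sum (a * z) n) as Hg.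
  set (s := sum_n (fun k : nat => ((a * z) ^ k)%C) n) in *.
  assert (E : (s - / (1 - a * z))%C = (- ((a * z) ^ S n / (1 - a * z)))%C).
  { replace ((a * z) ^ S n)%C with ((a * z - 1) * s + 1)%C.
    - field. exact Hne.
    - rewrite Hg. ring. }
  rewrite E, Cmod_opp, Cmod_div, Cmod_pow by exact Hne.
  apply Rlt_div_l; [lra|]. nra.
Qed.

(** The difference quotient minus the derivative equals
    (be + al a) a (y - z) / ((1 - a y) (1 - a z)^2), where 1 - a y and 1 - a z are
    at least 1 - a in modulus once y lies in the disk. *)
Lemma moebius_is_derive (al be : C) (a : R) (z : C) :
  0 <= a < 1 -> in_disk z ->
  is_derive (K := C_AbsRing) (V := C_NormedModule)
    (fun y : C => ((al + be * y ^ 1) * / (1 - a * y))%C) z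
    ((be + al * a) / (1 - a * z) ^ 2)%C.
Proof.
  intros Ha Hz. split; [apply is_linear_scal_l|].
  intros y0 Hy0 [eps He].
  apply (is_filter_lim_locally_unique (K := C_AbsRing)
    (V := AbsRing_NormedModule C_AbsRing)) in Hy0. subst y0.
  pose proof (geometric_denominator a z Ha Hz) as Hmz.
  pose proof (geometric_denominator_neq_0 a z Ha Hz) as Hnz.
  set (K := Cmod ((be + al * a) * a)%C).
  assert (HK : 0 <= K) by apply Cmod_ge_0.
  assert (Hd1 : 0 < 1 - Cmod z) by (unfold in_disk in Hz; lra).
  assert (Hm3 : 0 < (1 - a) ^ 3) by (apply pow_lt; lra).
  assert (Hd2 : 0 < eps * (1 - a) ^ 3 / (K + 1)).
  { apply Rdiv_lt_0_compat; [nra|lra]. }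
  exists (mkposreal _ (Rmin_pos _ _ Hd1 Hd2)). intros y Hy.
  change (Cmod (y - z)%C < Rmin (1 - Cmod z) (eps * (1 - a) ^ 3 / (K + 1))) in Hy.
  pose proof (Rlt_le_trans _ _ _ Hy (Rmin_l _ _)) as Hy1.
  pose proof (Rlt_le_trans _ _ _ Hy (Rmin_r _ _)) as Hy2.
  assert (Hyd : in_disk y).
  { unfold in_disk. replace y with (z + (y - z))%C by ring.
    eapply Rle_lt_trans; [apply Cmod_triangle|]. lra. }
  pose proof (geometric_denominator a y Ha Hyd) as Hmy.
  pose proof (geometric_denominator_neq_0 a y Ha Hyd) as Hny.
  change (Cmod ((al + be * y ^ 1) * / (1 - a * y) - (al + be * z ^ 1) * / (1 - a * z)
            - (y - z) * ((be + al * a) / (1 - a * z) ^ 2))%C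
          <= eps * Cmod (y - z)%C).
  replace ((al + be * y ^ 1) * / (1 - a * y) - (al + be * z ^ 1) * / (1 - a * z)
            - (y - z) * ((be + al * a) / (1 - a * z) ^ 2))%C
    with ((be + al * a) * a * (y - z) * (y - z)
          / ((1 - a * y) * ((1 - a * z) * (1 - a * z))))%C
    by (field; split; assumption).
  rewrite Cmod_div by (repeat apply Cmult_neq_0; assumption).
  rewrite (Cmod_mult (1 - a * y)), (Cmod_mult (1 - a * z)).
  rewrite (Cmod_mult ((be + al * a) * a * (y - z))), (Cmod_mult ((be + al * a) * a)).
  fold K. set (D := Cmod (y - z)%C) in *.
  assert (HD : 0 <= D) by apply Cmod_ge_0.
  assert (Hmm : (1 - a) ^ 3
    <= Cmod (1 - a * y)%C * (Cmod (1 - a * z)%C * Cmod (1 - a * z)%C)).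
  { replace ((1 - a) ^ 3) with ((1 - a) * ((1 - a) * (1 - a))) by ring.
    repeat apply Rmult_le_compat; nra. }
  apply Rle_div_l; [lra|].
  apply Rle_trans with (eps * D * (1 - a) ^ 3); [|apply Rmult_le_compat_l; nra].
  apply Rlt_div_r in Hy2; [|lra].
  replace (K * D * D) with (D * (D * K)) by ring.
  replace (eps * D * (1 - a) ^ 3) with (D * (eps * (1 - a) ^ 3)) by ring.
  apply Rmult_le_compat_l; [exact HD|]. nra.
Qed.

(** (a - z) / (1 - a z), written in the shape (al + be z^1) / (1 - a z) whose
    coefficients and derivative are known. *)
Definition extremal_h (a : R) (z : C) : C := ((a + (- 1) * z ^ 1) * / (1 - a * z))%C.

(** Equals [extremal_h a z - a]. *)
Definition extremal_g (a : R) (z : C) : C :=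
  ((0 + (a ^ 2 - 1)%R * z ^ 1) * / (1 - a * z))%C.

Definition extremal_a (a : R) : nat -> C :=
  mul_binomial a (- 1) 1 (fun k : nat => RtoC (a ^ k)).

Definition extremal_b (a : R) : nat -> C :=
  mul_binomial 0 (a ^ 2 - 1)%R 1 (fun k : nat => RtoC (a ^ k)).

(** |1 - a z|^2 - |a - z|^2 = (1 - a^2) (1 - |z|^2). *)
Lemma Cmod_extremal_h_le_1 (a : R) (z : C) :
  0 <= a < 1 -> in_disk z -> Cmod (extremal_h a z) <= 1.
Proof.
  intros Ha Hz. unfold extremal_h.
  pose proof (geometric_denominator a z Ha Hz) as Hm.
  pose proof (geometric_denominator_neq_0 a z Ha Hz) as Hne.
  fold (Cdiv (a + (- 1) * z ^ 1)%C (1 - a * z)%C).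
  rewrite Cmod_div by exact Hne.
  apply Rle_div_l; [lra|]. rewrite Rmult_1_l.
  unfold in_disk in Hz. pose proof (Cmod_ge_0 z) as Hz0.
  assert (Hz2 : Cmod z ^ 2 <= 1) by nra. rewrite Cmod2_alt in Hz2.
  apply Rsqr_incr_0_var; [|apply Cmod_ge_0]. rewrite !Rsqr_pow2, !Cmod2_alt.
  assert (Hprod : 0 <= (1 - a ^ 2) * (1 - (Re z ^ 2 + Im z ^ 2)))
    by (apply Rmult_le_pos; nra).
  destruct z as [p s]. simpl in *. lra.
Qed.

(** At z = - x with x real the value (a + x) / (1 + a x) is at least x, so the
    supremum 1 is approached as x tends to 1. *)
Lemma extremal_h_sup (a : R) : 0 <= a < 1 -> sup_norm_disk (extremal_h a) = 1.
Proof.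
  intros Ha. apply is_lub_Rbar_unique. split.
  - intros x (z & Hz & ->). apply Cmod_extremal_h_le_1; assumption.
  - intros b Hb.
    assert (Hx : forall x : R, 0 <= x < 1 -> Rbar_le x b).
    { intros x Hx.
      assert (Hz : in_disk (- x)%C)
        by (unfold in_disk; rewrite Cmod_opp, Cmod_R, Rabs_pos_eq; lra).
      refine (Rbar_le_trans _ _ _ _ (Hb _ (ex_intro _ _ (conj Hz eq_refl)))).
      assert (E : extremal_h a (- x)%C = RtoC ((a + x) / (1 + a * x))).
      { unfold extremal_h. rewrite RtoC_div by nra.
        rewrite !RtoC_plus, RtoC_mult. unfold Cdiv. f_equal; [ring|f_equal; ring]. }
      rewrite E, Cmod_R. simpl. eapply Rle_trans; [|apply Rle_abs].
      assert (0 <= a * x) by (apply Rmult_le_pos; lra).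
      assert (0 <= a * ((1 - x) * (1 + x)))
        by (apply Rmult_le_pos; [lra|apply Rmult_le_pos; lra]).
      apply Rle_div_r; lra. }
    destruct b as [b| |]; [|exact I|exact (Hx 0 ltac:(lra))].
    simpl in *. destruct (Rle_lt_dec 1 b) as [|Hb1]; [assumption|].
    pose proof (Hx 0 ltac:(lra)). specialize (Hx ((1 + b) / 2) ltac:(lra)). lra.
Qed.

(** Both numerators give be + al a = a^2 - 1, so g' = h' and the dilatation
    condition holds with equality. *)
Lemma extremal_admissible (a : R) :
  0 <= a < 1 ->
  admissible (fun z : C => (extremal_h a z + Cconj (extremal_g a z))%C)
    (extremal_h a) (extremal_g a) (extremal_a a) (extremal_b a).
Proof.
  intros Ha.
  pose proof (fun al be z => moebius_is_derive al be a z Ha) as Hd.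
  split.
  - reflexivity.
  - intros z Hz. eexists. apply Hd, Hz.
  - intros z Hz. eexists. apply Hd, Hz.
  - apply mul_binomial_series, geometric_series, Ha.
  - apply mul_binomial_series, geometric_series, Ha.
  - unfold extremal_b, mul_binomial. simpl. ring.
  - apply extremal_h_sup, Ha.
  - intros z Hz. right. unfold extremal_h, extremal_g.
    rewrite (is_C_derive_unique _ _ _ (Hd a (- 1)%C z Hz)).
    rewrite (is_C_derive_unique _ _ _ (Hd 0 ((a ^ 2 - 1)%R)%C z Hz)).
    f_equal. f_equal. rewrite RtoC_minus, RtoC_pow. ring.
Qed.

Lemma extremal_bohr_term (a r : R) (k : nat) :
  0 <= a < 1 ->
  bohr_term (extremal_a a) (extremal_b a) r (S k)
  = 2 * (1 - a ^ 2) * r * (a * r) ^ k.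
Proof.
  intros Ha.
  assert (HA : extremal_a a (S k) = RtoC ((a ^ 2 - 1) * a ^ k)).
  { unfold extremal_a, mul_binomial. cbn [Nat.leb Nat.sub]. rewrite Nat.sub_0_r.
    rewrite <- tech_pow_Rmult.
    rewrite !RtoC_mult, RtoC_minus, RtoC_pow. rewrite !RtoC_pow. ring. }
  assert (HB : extremal_b a (S k) = RtoC ((a ^ 2 - 1) * a ^ k)).
  { unfold extremal_b, mul_binomial. cbn [Nat.leb Nat.sub]. rewrite Nat.sub_0_r.
    rewrite (RtoC_mult (a ^ 2 - 1)). ring. }
  unfold bohr_term. rewrite HA, HB, Cmod_R, Rabs_mult.
  rewrite Rabs_left1 by nra. rewrite Rabs_pos_eq by (apply pow_le; lra).
  rewrite Rpow_mult_distr. simpl pow. ring.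
Qed.

Lemma extremal_bohr_sum (a r : R) (z : C) :
  0 <= a < 1 -> 0 <= r < 1 ->
  ex_series (fun k : nat => bohr_term (extremal_a a) (extremal_b a) r (S k)) /\
  a + 2 * (1 - a ^ 2) * r / (1 - a * r)
  <= bohr_sum (extremal_h a) (extremal_a a) (extremal_b a) r z.
Proof.
  intros Ha Hr.
  assert (Hs : is_series (fun k : nat => bohr_term (extremal_a a) (extremal_b a) r (S k))
                 (2 * (1 - a ^ 2) * r * / (1 - a * r))).
  { apply (is_series_ext (fun k : nat => 2 * (1 - a ^ 2) * r * (a * r) ^ k)).
    { intros k. symmetry. apply extremal_bohr_term, Ha. }
    apply (is_series_scal (K := R_AbsRing) (V := R_NormedModule)).
    apply is_series_geom. rewrite Rabs_pos_eq; nra. }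
  split; [eexists; exact Hs|].
  unfold bohr_sum. rewrite (is_series_unique _ _ Hs).
  assert (E : extremal_a a 0%nat = RtoC a).
  { unfold extremal_a, mul_binomial. simpl. ring. }
  rewrite E, Cmod_R, Rabs_pos_eq by lra.
  pose proof (pow2_ge_0 (Cmod (extremal_h a z - a)%C)).
  unfold Rdiv. lra.
Qed.

(** For r > 1/5 the condition r (2 + 3 a) > 1 reads a > (1/r - 2) / 3; the
    witness (1 + 1/r) / 6 is the midpoint between this threshold and 1. Taking
    r <= 1/2 keeps the threshold nonnegative. *)
Lemma bohr_sharpness (rho : R) :
  1 / 5 < rho ->
  exists (f h g : C -> C) (a b : nat -> C),
    admissible f h g a b /\
    exists (z : C) (r : R),
      in_disk z /\ Cmod z = r /\ r <= rho /\
      ex_series (fun k : nat => bohr_term a b r (S k)) /\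
      1 < bohr_sum h a b r z.
Proof.
  intros Hrho. set (r := Rmin rho (1 / 2)).
  assert (Hr1 : 1 / 5 < r) by (apply Rmin_glb_lt; lra).
  assert (Hr2 : r <= 1 / 2) by apply Rmin_r.
  set (a := (1 + / r) / 6).
  assert (Hri : / r * r = 1) by (field; lra).
  assert (Hi2 : 2 <= / r) by nra.
  assert (Hi5 : / r < 5) by nra.
  assert (Ha : 0 <= a < 1) by (unfold a; lra).
  assert (Har : 6 * (a * r) = r + 1) by (unfold a; nra).
  destruct (extremal_bohr_sum a r r Ha ltac:(lra)) as [Hex Hle].
  do 5 eexists. split; [apply (extremal_admissible a Ha)|].
  exists (RtoC r), r. unfold in_disk. rewrite Cmod_R, Rabs_pos_eq by lra.
  repeat split; [lra|apply Rmin_l|exact Hex|].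
  eapply Rlt_le_trans; [|exact Hle].
  enough (1 - a < 2 * (1 - a ^ 2) * r / (1 - a * r)) by lra.
  apply Rlt_div_r; [lra|].
  replace (2 * (1 - a ^ 2) * r) with ((1 - a) * (2 * r + 2 * (a * r))) by ring.
  apply Rmult_lt_compat_l; lra.
Qed.

Theorem theorem3 :
  (forall (f h g : C -> C) (a b : nat -> C),
     admissible f h g a b ->
     forall (z : C) (r : R), in_disk z -> Cmod z = r -> r <= 1 / 5 ->
       ex_series (fun k : nat => bohr_term a b r (S k)) /\
       bohr_sum h a b r z <= 1)
  /\
  (forall rho : R, 1 / 5 < rho ->
     exists (f h g : C -> C) (a b : nat -> C),
       admissible f h g a b /\
       exists (z : C) (r : R),
         in_disk z /\ Cmod z = r /\ r <= rho /\
         ex_series (fun k : nat => bohr_term a b r (S k)) /\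
         1 < bohr_sum h a b r z).
Proof.
  split; [|exact bohr_sharpness].
  intros f h g a b H z r. now apply (bohr_inequality f h g a b).
Qed.
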